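(* For every sufficiently large integer $r$ and every integer $k\ge2$, $$p_k(r)\ge (1-o(1))\,r\log\log r,$$ where the $o(1)$ term depends only on $r$ (in particular, neither it nor the meaning of ''sufficiently large'' depends on $k$) and tends to $0$ as $r\to\infty$.
   Context: An $r$-edge-coloured complete graph is a finite complete graph each of whose edges is assigned one of $r$ colours (not necessarily properly, and not all colours need be used). For $k\ge2$, $p_k(r)$ denotes the minimum number of connected monochromatic $k$-regular graphs and single vertices required to partition any $r$-edge-coloured complete graph; that is, the smallest integer $p$ such that the vertex set of every $r$-edge-coloured complete graph can be partitioned into at most $p$ parts, each of which is either a single vertex or the vertex set of a connected $k$-regular subgraph (not necessarily induced) all of whose edges have the same colour. (This number is known to be finite.) Logarithms are natural. *)

(* Defs.v *)
From HB Require Import structures.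
From mathcomp Require Import all_boot all_order all_algebra.

Set Implicit Arguments.
Unset Strict Implicit.
Unset Printing Implicit Defensive.

(* An [r]-edge-colouring of the complete graph on [V]. The diagonal values do
   not correspond to edges; nothing below depends on them. *)
Definition edge_colouring (V : finType) (r : nat) (c : V -> V -> 'I_r) : Prop :=
  forall x y, c x y = c y x.

(* The pair [(S, g)] is a simple graph with vertex set [S]. *)
Definition simple_graph_on (V : finType) (S : {set V}) (g : rel V) : Prop :=
  [/\ symmetric g, irreflexive g
    & forall x y, g x y -> x \in S /\ y \in S].

Definition regular_on (V : finType) (k : nat) (S : {set V}) (g : rel V) : Prop :=
  {in S, forall x, #|[set y in S | g x y]| = k}.

(* [connect g] is the reflexive transitive closure of [g]; it is only used
   for graphs on [S], whose edges all lie inside [S]. *)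
Definition connected_on (V : finType) (S : {set V}) (g : rel V) : Prop :=
  S != set0 /\ {in S &, forall x y, connect g x y}.

Definition monochromatic (V : finType) (r : nat)
    (c : V -> V -> 'I_r) (g : rel V) : Prop :=
  exists i : 'I_r, forall x y, g x y -> c x y = i.

Definition admissible_part (V : finType) (k r : nat)
    (c : V -> V -> 'I_r) (S : {set V}) : Prop :=
  (exists x, S = [set x]) \/
  exists g : rel V,
    [/\ simple_graph_on S g, regular_on k S g, connected_on S g
      & monochromatic c g].

Definition partition_bound (k r p : nat) : Prop :=
  forall (V : finType) (c : V -> V -> 'I_r), edge_colouring c ->
  exists P : {set {set V}},
    [/\ partition P [set: V], #|P| <= p
      & forall S, S \in P -> admissible_part k c S].

From mathcomp Require Import all_classical all_reals all_analysis.
Import Order.TTheory GRing.Theory Num.Theory.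
Import numFieldNormedType.Exports.
Local Open Scope classical_set_scope.
Local Open Scope ring_scope.

(* The least [p] with [partition_bound k r p], as an extended real: the value
   would be [+oo] if there were no such [p] (see [pk_min]). *)
Definition pk (R : realType) (k r : nat) : \bar R :=
  ereal_inf [set (p%:R : R)%:E | p in [set p : nat | partition_bound k r p]].

Lemma pk_min (R : realType) (k r p : nat) :
  partition_bound k r p -> (forall q, partition_bound k r q -> (p <= q)%N) ->
  pk R k r = (p%:R)%:E.
Proof.
move=> hp minp; apply/eqP; rewrite eq_le; apply/andP; split.
  by apply: ereal_inf_lbound; exists p.
by apply: le_ereal_inf_tmp => _ [q /= hq <-]; rewrite lee_fin ler_nat minp.
Qed.

(* Main.v *)
Require Import Defs.
From HB Require Import structures.
From mathcomp Require Import all_boot all_order all_algebra.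
From mathcomp Require Import zify ring lra.
Set Implicit Arguments.
Unset Strict Implicit.
Unset Printing Implicit Defensive.

(** The idea.  The vertices are spread evenly over blocks, and the blocks are
    grouped into [X] levels, where [X] is of order [ln r / ln (ln r)].  Level [l]
    has [K ^ (l + 1)] blocks with [K] about [(ln r) ^ 2], so that a level is
    much larger than all lower levels together.  A small portion of the [r]
    colours, [d] of them with [d] about [e r / 8], is special, and the others are
    split into one palette of [q] colours for each level.  Edges inside a level
    have special colours.  A vertex [v] of level [y] carries an injection
    [slot v] from the blocks to the palette of [y], and the edges from [v] to a
    block [b] of a higher level have the colour [slot v b] of that palette; every
    injection occurs equally often in every block.

    Because [slot v] is injective, a connected graph whose edges have the colour
    [j] of the palette of [y] lives between a single block [b] and the vertices
    [v] of level [y] with [slot v b = j], and if it is regular then it has as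
    many vertices on either side ([main_part_star]).  Call its vertex set a star
    part.  Consider the ways to cover level [y].
    - Star parts whose block lies in level [y] take the same number of vertices
      from lower levels, so they cover a negligible portion of level [y].
    - A star part with block [b] and colour [j] of the palette of [y] covers
      about [1 / q] of level [y], and for different blocks these portions are
      nearly independent.  Using one block with very many colours would break
      the independence, but the parts are disjoint, and one block does not have
      enough vertices to contribute much.  So [t] such parts leave a portion of
      about [expR (- t / q)] of level [y] ([card_avoiding]).
    - A special part stays in one level and covers at most [2 / d] of it
      ([special_part_small]).
    Hence the number of special parts and single vertices in level [y] is at
    least about [(d / 2) expR (- t / q)] ([level_bound]).  If there are [T] parts
    in all, then convexity of the exponential function gives, after summation
    over the levels, that [X expR (- T / (X q))] is at most about [2 T / d]
    ([partition_size_bound]).  Here [X q] is about [r], so for [T] below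
    [(1 - e) r ln (ln r)] the left side exceeds [X (ln r) ^ (e / 2 - 1)], which is
    of order [(ln r) ^ (e / 2) / ln (ln r)], whereas the right side is at most of
    order [ln (ln r) / e].  This is a contradiction even for [e] of order
    [(ln (ln r)) ^ (-1/4)]. *)

(** * Regular graphs *)

Lemma connect_invariant (T : finType) (g : rel T) (Q : pred T) :
  (forall x y, g x y -> Q x -> Q y) -> forall x y, connect g x y -> Q x -> Q y.
Proof.
move=> gQ x y /connectP[p gp ->]; elim: p x gp => //= z p IHp x /andP[xz zp] Qx.
by apply: IHp => //; apply: gQ xz Qx.
Qed.

(** Each of the [k * #|A|] edges that leave [A] ends in [S :\: A], where a vertex
    receives at most [k] of them. *)
Lemma regular_independent (V : finType) k (S A : {set V}) (g : rel V) :
  0 < k -> symmetric g -> regular_on k S g -> A \subset S ->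
  {in A &, forall x y, ~~ g x y} -> #|A| <= #|S :\: A|.
Proof.
move=> k_gt0 gsym greg sAS Aindep; rewrite -(leq_pmul2r k_gt0) -!sum_nat_const.
have sumE x (D : {set V}) : #|[set y in D | g x y]| = \sum_(y in D) g x y.
  rewrite -sum1_card big_mkcond [RHS]big_mkcond; apply: eq_bigr => y _.
  by rewrite inE; case: (y \in D); case: (g x y).
have -> : \sum_(x in A) k = \sum_(x in A) \sum_(y in S :\: A) g x y.
  apply: eq_bigr => x xA; rewrite -(greg x (subsetP sAS x xA)) -sumE.
  apply: eq_card => y; rewrite !inE; case yA: (y \in A) => //=.
  by rewrite (negPf (Aindep x y xA yA)) andbF.
rewrite exchange_big /=; apply: leq_sum => y /setDP[yS yA].
under eq_bigr do rewrite gsym.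
rewrite -sumE -(greg y yS); apply/subset_leq_card/fintype.subsetP => x.
by rewrite !inE => /andP[/(subsetP sAS) -> ->].
Qed.

(** * The colouring *)

Section Construction.
Variables (X q d : nat) (B : finType) (lev : B -> 'I_X).

Definition injection : finType := {f : {ffun B -> 'I_q} | injectiveb f}.

(** A vertex consists of the injection that colours its edges to higher levels,
    the index that determines special colours, and its block.  In this product
    every injection and every index occurs equally often in every block. *)
Definition vertex : finType := (injection * 'I_d * B)%type.

(** [inl (y, j)] is the colour [j] of the palette of level [y], and [inr i] is a
    special colour. *)
Definition colour : finType := ('I_X * 'I_q + 'I_d)%type.

Implicit Types (u v w : vertex) (y : 'I_X) (b : B) (S : {set vertex}).

Definition level v := lev v.2.
Definition slot v b : 'I_q := val v.1.1 b.

Lemma slot_inj v : injective (slot v).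
Proof. exact/injectiveP/(valP v.1.1). Qed.

Definition edge_colour u v : colour :=
  if level u == level v then
    inr (if (u.1.2 <= v.1.2)%N then u.1.2 else v.1.2)
  else if level v < level u then inl (level v, slot v u.2)
  else inl (level u, slot u v.2).

Lemma edge_colourC u v : edge_colour u v = edge_colour v u.
Proof.
rewrite /edge_colour eq_sym; case: eqVneq => [_|neq].
  by congr inr; case: ltngtP => // /val_inj.
by case: ltngtP => // /val_inj eq; rewrite eq eqxx in neq.
Qed.

Lemma edge_colour_special u v i :
  edge_colour u v = inr i -> level u = level v /\ (u.1.2 = i \/ v.1.2 = i).
Proof.
rewrite /edge_colour; case: eqP => [-> [<-]|_]; last by case: ifP.
by case: ifP; [split=> //; left | split=> //; right].
Qed.

Lemma edge_colour_main u v y j : edge_colour u v = inl (y, j) ->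
  [/\ level v = y, y < level u & slot v u.2 = j] \/
  [/\ level u = y, y < level v & slot u v.2 = j].
Proof.
rewrite /edge_colour; case: eqP => // neq; case: ltngtP => // [lt|lt|].
- by case=> <- <-; left.
- by case=> <- <-; right.
by move/val_inj/esym.
Qed.

Definition level_set y := [set v | level v == y].
Definition below_set y := [set v | level v < y].
Definition block b := [set v : vertex | v.2 == b].

(** The size bound holds for special parts and for single vertices alike, so that
    these two sorts of parts can be counted together. *)
Definition small_part y S : bool :=
  (S \subset level_set y) && (d * #|S| <= 2 * #|level_set y|).

Definition star_part y b (j : 'I_q) S : bool :=
  [&& y < lev b,
      [forall (v | v \in S), (v.2 == b) || (level v == y) && (slot v b == j)] &
      #|S :&: level_set y| == #|S :&: block b|].

Lemma card_level_set y :
  #|level_set y| = #|injection| * d * #|[set b | lev b == y]|.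
Proof.
rewrite -[in RHS](card_ord d) -!cardsT -!cardsX.
by apply: eq_card => -[[f i] b]; rewrite !inE.
Qed.

Lemma card_below_set y :
  #|below_set y| = #|injection| * d * #|[set b | lev b < y]|.
Proof.
rewrite -[in RHS](card_ord d) -!cardsT -!cardsX.
by apply: eq_card => -[[f i] b]; rewrite !inE.
Qed.

Lemma card_block b : #|block b| = #|injection| * d.
Proof.
rewrite -[RHS]muln1 -(cards1 b) -[in RHS](card_ord d) -!cardsT -!cardsX.
by apply: eq_card => -[[f i] b']; rewrite !inE.
Qed.

(** In the special colour [i], the vertices of the part whose index is not [i]
    are independent, so they are at most as many as the vertices of index [i],
    which make up a portion [1 / d] of the level. *)
Lemma special_part_small k y i S (g : rel vertex) :
  0 < k -> simple_graph_on S g -> regular_on k S g -> S \subset level_set y ->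
  (forall u v, g u v -> edge_colour u v = inr i) -> small_part y S.
Proof.
move=> k_gt0 [gsym _ _] greg Sy gi; rewrite /small_part Sy /=.
pose D := [set v in level_set y | v.1.2 == i].
have cardD : d * #|D| = #|level_set y|.
  have -> : D = setX (setX [set: injection] [set i]) [set b | lev b == y].
    by apply/setP => -[[f i'] b]; rewrite !inE /= andbC.
  by rewrite card_level_set !cardsX cards1 muln1 cardsT mulnCA mulnA.
have: #|S :\: D| <= #|S :\: (S :\: D)|.
  apply: (regular_independent k_gt0 gsym greg (subsetDl _ _)) => u v.
  move=> /setDP[/(subsetP Sy) uy uD] /setDP[/(subsetP Sy) vy vD].
  apply/negP => /gi /edge_colour_special[_]; rewrite !inE in uy vy uD vD.
  by case=> ii; move: uD vD; rewrite uy vy ii eqxx.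
rewrite setDDr finset.setDv finset.set0U => le.
have le2 : #|S :&: D| <= #|D| by apply/subset_leq_card/subsetIr.
by rewrite -cardD -(cardsID D S); nia.
Qed.

(** Along an edge of colour [inl (y, j)] the block [b] that the edge uses does not
    change: a vertex of level [y] reaches only one block in the colour [j], since
    its [slot] is injective.  By connectedness [b] is the same throughout, the
    graph is bipartite, and regularity balances the two sides. *)
Lemma main_part_star k y j u0 v0 S (g : rel vertex) :
  0 < k -> simple_graph_on S g -> regular_on k S g -> connected_on S g ->
  (forall u v, g u v -> edge_colour u v = inl (y, j)) -> g u0 v0 ->
  exists b, star_part y b j S.
Proof.
move=> k_gt0 [gsym girr gS] greg [_ gconn] gyj.
wlog [vy uy uj] : u0 v0 / [/\ level v0 = y, y < level u0 & slot v0 u0.2 = j].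
  move=> wl guv; case: (edge_colour_main (gyj _ _ guv)) => H; first exact: wl guv.
  by apply: (wl v0 u0) => //; rewrite gsym.
move=> guv; pose b := u0.2; have yb : y < lev b by [].
pose Q v := (v.2 == b) || (level v == y) && (slot v b == j).
have Qstep u v : g u v -> Q u -> Q v.
  move=> gxy; case: (edge_colour_main (gyj _ _ gxy)) => -[e1 e2 e3] /orP[/eqP e|].
  - by rewrite /Q e1 -e e3 !eqxx orbT.
  - by case/andP=> /eqP e _; rewrite e ltnn in e2.
  - by move: yb; rewrite -e [lev _]e1 ltnn.
  by case/andP=> _ /eqP e; rewrite /Q (slot_inj (etrans e3 (esym e))) eqxx.
have QS : {in S, forall v, Q v}.
  move=> v vS; have [uS _] := gS _ _ guv.
  by apply: (connect_invariant Qstep (gconn _ _ uS vS)); rewrite /Q eqxx.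
have lev_indep u v : level u = level v -> ~~ g u v.
  by move=> e; apply/negP => /gyj; rewrite /edge_colour e eqxx.
exists b; apply/and3P; split=> //; first by apply/forall_inP => v /QS.
(* [b] lies above level [y], so level [y] and [b] split [S] in two. *)
have compl : S :\: (S :&: level_set y) = S :&: block b.
  apply/setP => v; rewrite !inE; case vS: (v \in S); rewrite ?andbF //= !andbT.
  apply/idP/eqP => [vny|e]; first by case/orP: (QS v vS) => [/eqP //|/andP[/(negP vny)]].
  by apply/eqP => vy'; move: yb; rewrite -e [lev _]vy' ltnn.
have compl' : S :\: (S :&: block b) = S :&: level_set y.
  by rewrite -compl setDDr finset.setDv finset.set0U finset.setIA finset.setIid.
rewrite eqn_leq; apply/andP; split.
  rewrite -compl; apply: (regular_independent k_gt0 gsym greg (subsetIl _ _)) => u v.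
  by rewrite !inE => /andP[_ /eqP e1] /andP[_ /eqP e2]; rewrite lev_indep ?e1.
rewrite -compl'; apply: (regular_independent k_gt0 gsym greg (subsetIl _ _)) => u v.
by rewrite !inE => /andP[_ /eqP e1] /andP[_ /eqP e2]; rewrite lev_indep // /level e1 e2.
Qed.

Lemma card_level_set_ge y v : 0 < d -> level v = y -> d <= 2 * #|level_set y|.
Proof.
move=> d_gt0 vy; rewrite card_level_set.
have s_gt0 : 0 < #|injection| by apply/card_gt0P; exists v.1.1.
have N_gt0 : 0 < #|[set b | lev b == y]|.
  by apply/card_gt0P; exists v.2; rewrite inE [lev _]vy.
by rewrite mulnAC mulnA leq_pmull // !muln_gt0 s_gt0.
Qed.

Definition part_kind : finType := ('I_X + 'I_X * B * 'I_q)%type.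

Definition has_kind (c : part_kind) S : bool :=
  match c with
  | inl y => small_part y S
  | inr (y, b, j) => star_part y b j S
  end.

Lemma admissible_part_kind k r (emb : colour -> 'I_r) S :
  0 < k -> 0 < d -> injective emb ->
  admissible_part k (fun u v => emb (edge_colour u v)) S ->
  exists c, has_kind c S.
Proof.
move=> k_gt0 d_gt0 emb_inj [[v ->]|[g [gsimple greg gconn [i gi]]]].
  exists (inl (level v)); rewrite /= /small_part finset.sub1set inE eqxx cards1 muln1.
  exact: card_level_set_ge.
have [gsym girr gS] := gsimple.
have [/set0Pn[u uS] gconn'] := gconn.
have /card_gt0P[v] : 0 < #|[set v in S | g u v]| by rewrite greg.
rewrite inE => /andP[vS guv].
have gE x z : g x z -> edge_colour x z = edge_colour u v.
  by move=> gxy; apply: emb_inj; rewrite (gi _ _ gxy) (gi _ _ guv).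
case cE: (edge_colour u v) gE => [[y j]|c] gE.
  have [b bS] := main_part_star k_gt0 gsimple greg gconn gE guv.
  by exists (inr (y, b, j)).
exists (inl (level u)); apply: (special_part_small k_gt0 gsimple greg _ gE).
apply/fintype.subsetP => w wS; rewrite inE.
apply: (@connect_invariant _ g (fun w => level w == level u) _ u w) => //.
  by move=> x z /gE/edge_colour_special[-> _].
exact: gconn'.
Qed.

Definition avoiding (R : B -> {set 'I_q}) : {set injection} :=
  [set s : injection | [forall b, val s b \notin R b]].

(** * Counting the vertices of a level *)

Section Counting.
Variables (P : {set {set vertex}}) (kind : {set vertex} -> part_kind) (h : nat).
Hypothesis Ppart : partition P [set: vertex].
Hypothesis kindP : {in P, forall S, has_kind (kind S) S}.

Definition small_parts y := [set S in P | kind S == inl y].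
Definition star_parts y :=
  [set S in P | if kind S is inr (y', _, _) then y' == y else false].
Definition used y b :=
  [set j | [exists S in P, kind S == inr (y, b, j)]].

(** A block is heavy if star parts use it with at least [h] colours.  Heavy
    blocks are treated separately: for them the bound on the covered portion by
    independence is too weak, but they are few and have few vertices. *)
Definition heavy y := [set b | h <= #|used y b|].
Definition light_used y b := if b \in heavy y then set0 else used y b.

(** The vertices of level [y] that no star part with a light block can contain on
    its lower side. *)
Definition uncovered y :=
  [set v in level_set y | [forall b, slot v b \notin light_used y b]].

Lemma sum_card_used y : \sum_b #|used y b| <= #|star_parts y|.
Proof.
pose f S := if kind S is inr (_, b, j) then Some (b, j) else None.
have sub : [set Some (bj.1, bj.2) | bj : B * 'I_q & bj.2 \in used y bj.1]
    \subset [set f S | S in star_parts y].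
  apply/fintype.subsetP => z /imsetP[[b j]]; rewrite !inE /=.
  case/exists_inP => S SP /eqP kS ->.
  by apply/imsetP; exists S; rewrite ?inE ?SP /f kS //=.
apply: leq_trans (leq_imset_card f _); apply: leq_trans (subset_leq_card sub).
rewrite card_imset; last by move=> [b j] [b' j'] [-> ->].
rewrite -sum1_card (eq_bigl (fun bj => predT bj.1 && (bj.2 \in used y bj.1))).
  rewrite -(pair_big_dep predT (fun b j => j \in used y b) (fun _ _ => 1)) /=.
  by apply: leq_sum => b _; rewrite sum1_card.
by move=> bj; rewrite !inE.
Qed.

Lemma card_heavy y : h * #|heavy y| <= #|star_parts y|.
Proof.
apply: leq_trans (sum_card_used y).
rewrite mulnC -sum_nat_const [X in _ <= X](bigID (mem (heavy y))) /=.
by apply: leq_trans (leq_addr _ _); apply: leq_sum => b; rewrite inE.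
Qed.

Lemma card_partition_setI (A : {set vertex}) :
  #|A| = \sum_(S in P) #|S :&: A|.
Proof.
have cardE (D : {set vertex}) : #|D :&: A| = \sum_(v in D) (v \in A).
  rewrite -sum1_card big_mkcond [RHS]big_mkcond; apply: eq_bigr => v _.
  by rewrite inE; case: (v \in D); case: (v \in A).
rewrite -[A in LHS]finset.setTI cardE (set_partition_big _ Ppart).
by apply: eq_bigr => S _; rewrite cardE.
Qed.

(** A part meets [uncovered y] either because it is small and lies in level [y],
    or as a star part whose block is in level [y], when it takes equally many
    vertices from lower levels, or as a star part with a heavy block, when it
    takes equally many vertices from this block. *)
Lemma card_uncovered_part y S : S \in P ->
  #|S :&: uncovered y| <= (kind S == inl y) * #|S| + #|S :&: below_set y|
     + \sum_(b in heavy y) #|S :&: block b|.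
Proof.
move=> SP; have := kindP SP; case kS: (kind S) => [y'|[[y' b] j]] /=.
  case/andP=> Sy' _; case: (eqVneq y' y) => [<-|neq].
    rewrite eqxx mul1n -addnA; apply: leq_trans (leq_addr _ _).
    exact/subset_leq_card/subsetIl.
  rewrite (_ : S :&: uncovered y = set0) ?cards0 //; apply/setP => v.
  rewrite !inE; apply/negP => /and3P[/(subsetP Sy')]; rewrite inE => /eqP -> /eqP e.
  by rewrite e eqxx in neq.
case/and3P=> yb /forall_inP Sb /eqP bal.
case: (eqVneq y' y) => [ey|neq].
  subst y'; case bh: (b \in heavy y).
    rewrite (bigD1 b) //= -bal addnA addnAC; apply: leq_trans (leq_addl _ _).
    by apply/subset_leq_card/finset.setIS/fintype.subsetP => v; rewrite inE => /andP[].
  rewrite (_ : S :&: uncovered y = set0) ?cards0 //; apply/setP => v.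
  rewrite !inE; apply/negP => /and3P[vS /eqP vy /forallP/(_ b)].
  rewrite /light_used bh inE; case/exists_inP; exists S => //.
  rewrite kS; case/orP: (Sb v vS) => [/eqP e|/andP[_ /eqP -> //]].
  by move: yb; rewrite -e [lev _]vy ltnn.
apply: leq_trans (leq_addr _ _); apply: leq_trans (leq_addl _ _).
have [->|[v]] := set_0Vmem (S :&: uncovered y); first by rewrite cards0.
have sub w : w \in S :&: uncovered y -> w.2 = b.
  rewrite !inE => /and3P[wS /eqP wy _]; case/orP: (Sb w wS) => [/eqP //|/andP[]].
  by rewrite wy eq_sym (negPf neq).
move=> vW; have y'y : y' < y.
  by move: (vW); rewrite !inE => /and3P[_ /eqP <- _]; rewrite /level (sub v vW).
apply: (@leq_trans #|S :&: block b|).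
  apply/subset_leq_card/fintype.subsetP => w wW; rewrite !inE (sub w wW) eqxx andbT.
  by move: wW; rewrite inE => /andP[].
rewrite -bal; apply/subset_leq_card/finset.setIS/fintype.subsetP => w.
by rewrite !inE => /eqP ->.
Qed.

Lemma card_uncovered y :
  d * #|uncovered y| <= 2 * #|small_parts y| * #|level_set y|
    + d * #|below_set y| + d * (#|heavy y| * (#|injection| * d)).
Proof.
have : \sum_(S in P) #|S :&: uncovered y| <=
    \sum_(S in P) ((kind S == inl y) * #|S| + #|S :&: below_set y|
                    + \sum_(b in heavy y) #|S :&: block b|).
  by apply: leq_sum => S; apply: card_uncovered_part.
rewrite -card_partition_setI !big_split /= -card_partition_setI exchange_big /=.
under [X in _ + X]eq_bigr do rewrite -card_partition_setI card_block.
rewrite sum_nat_const => le.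
have small : d * (\sum_(S in P) (kind S == inl y) * #|S|)
    <= 2 * #|small_parts y| * #|level_set y|.
  rewrite big_distrr mulnAC mulnC -sum_nat_const /=.
  rewrite [X in _ <= X](eq_bigl (fun S => (S \in P) && (kind S == inl y))); last first.
    by move=> S; rewrite inE.
  rewrite [X in _ <= X]big_mkcondr /=; apply: leq_sum => S SP.
  case: eqP => [kS|_]; last by rewrite mul0n muln0.
  by have := kindP SP; rewrite kS mul1n => /andP[].
apply: leq_trans (leq_mul (leqnn d) le) _.
by rewrite !mulnDr !leq_add2r.
Qed.

Lemma card_uncovered_avoiding y :
  #|uncovered y| = #|avoiding (light_used y)| * d * #|[set b | lev b == y]|.
Proof.
rewrite -[X in _ * X * _](card_ord d) -[X in _ * X * _]cardsT -!cardsX.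
by apply: eq_card => -[[f i] b]; rewrite !inE andbT andbC.
Qed.

Lemma card_avoiding_le y : 0 < d ->
  #|avoiding (light_used y)| * d * #|[set b | lev b == y]| <=
    #|injection| * (2 * #|small_parts y| * #|[set b | lev b == y]|
                    + d * #|[set b | lev b < y]| + d * #|heavy y|).
Proof.
move=> d_gt0; have := card_uncovered y.
rewrite card_uncovered_avoiding card_level_set card_below_set => le.
rewrite -(leq_pmul2l d_gt0); apply: leq_trans le _; lia.
Qed.

End Counting.

(** * Counting injections *)

(** If [f a = f b], then [f] can be recovered from the result of replacing its
    value at [a] by an arbitrary colour. *)
Lemma card_collision (a b : B) : a != b ->
  q * #|[set f : {ffun B -> 'I_q} | f a == f b]| <= q ^ #|B|.
Proof.
move=> neq; rewrite -[X in X ^ _](card_ord q) -card_ffun.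
pose upd (p : 'I_q * {ffun B -> 'I_q}) : {ffun B -> 'I_q} :=
  [ffun x => if x == a then p.1 else p.2 x].
rewrite -[X in X * _](card_ord q) -[X in X * _]cardsT -cardsX.
rewrite -(card_in_imset (f := upd)) ?max_card // => -[c f] [c' f'].
rewrite !inE /= => /eqP fab /eqP fab' /ffunP e.
have := e a; rewrite !ffunE eqxx => /= ->; congr pair; apply/ffunP => x.
(* off [a] nothing was changed; at [a], use the value at [b] *)
have fE z : z != a -> f z = f' z by move=> za; have := e z; rewrite !ffunE (negPf za).
by case: (eqVneq x a) => [->|/fE //]; rewrite fab fab' fE // eq_sym.
Qed.

Lemma card_not_injective :
  q * #|[set f : {ffun B -> 'I_q} | ~~ injectiveb f]| <= #|B| ^ 2 * q ^ #|B|.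
Proof.
pose coll (ab : B * B) := [set f : {ffun B -> 'I_q} | f ab.1 == f ab.2].
have sub : [set f : {ffun B -> 'I_q} | ~~ injectiveb f] \subset \bigcup_(ab | ab.1 != ab.2) coll ab.
  apply/fintype.subsetP => f; rewrite inE => /injectivePn[a [b neq e]].
  by apply/bigcupP; exists (a, b) => //; rewrite inE e.
have le : #|\bigcup_(ab | ab.1 != ab.2) coll ab| <= \sum_(ab | ab.1 != ab.2) #|coll ab|.
  elim/big_rec2: _ => [|ab m A _ le]; first by rewrite cards0.
  by apply: leq_trans (leq_card_setU _ _) _; rewrite leq_add2l.
apply: leq_trans (leq_mul (leqnn q) (leq_trans (subset_leq_card sub) le)) _.
rewrite big_distrr -mulnn -card_prod -sum_nat_const big_mkcond /=.
by apply: leq_sum => -[a b] _; case: ifP => //= /card_collision.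
Qed.

(** Among all functions, the values at different blocks are independent, so the
    product counts the functions that avoid [R].  The second summand on the right
    accounts for those of them that are not injective. *)
Lemma card_avoiding (R : B -> {set 'I_q}) :
  q * \prod_b (q - #|R b|) <= q * #|avoiding R| + #|B| ^ 2 * q ^ #|B|.
Proof.
have -> : \prod_b (q - #|R b|) = #|family (fun b => [pred j | j \notin R b])|.
  rewrite card_family foldrE big_map big_enum /=; apply: eq_bigr => b _.
  have := cardsC (R b); rewrite card_ord => qE; rewrite -[X in X - _]qE addKn.
  by apply: eq_card => j; rewrite !inE.
apply: leq_trans (leq_add (leqnn _) card_not_injective).
rewrite -mulnDr leq_mul2l -(card_imset _ val_inj); apply/orP; right.
apply: leq_trans (leq_card_setU _ _); apply/subset_leq_card/fintype.subsetP => f.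
move=> /familyP fR; rewrite inE [X in _ || X]inE; case finj: (injectiveb f); rewrite ?orbT //= orbF.
apply/imsetP; exists (Sub f finj : injection); rewrite ?SubK // inE SubK.
by apply/forallP => b; have := fR b; rewrite inE.
Qed.

Lemma card_injection : #|injection| <= q ^ #|B|.
Proof.
by rewrite card_sig (leq_trans (max_card _)) // card_ffun card_ord.
Qed.

End Construction.

(** * Levels of geometrically growing size *)

Lemma geometric_sum_le K n : 1 < K -> \sum_(l < n) K ^ l.+1 <= 2 * K ^ n.
Proof.
move=> K_gt1; elim: n => [|n IHn]; first by rewrite big_ord0.
rewrite big_ord_recr /= (expnS K n); apply: leq_trans (leq_add IHn (leqnn _)) _.
by rewrite mulnA -mulnDl mul2n -addnn leq_mul2r leq_add2r K_gt1 orbT.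
Qed.

Section Geometric.
Variables (X K : nat).
Definition geo_block : finType := {l : 'I_X & 'I_(K ^ l.+1)}.
Definition geo_level (b : geo_block) : 'I_X := tag b.

Lemma card_geo_block (Q : pred 'I_X) :
  #|[set b | Q (geo_level b)]| = \sum_(l < X | Q l) K ^ l.+1.
Proof.
rewrite -sum1_card (eq_bigl (fun b : geo_block => Q (tag b) && true)); last first.
  by move=> b; rewrite inE andbT.
rewrite -(sig_big_dep Q (fun l : 'I_X => fun _ : 'I_(K ^ l.+1) => true) (fun _ _ => 1)) /=.
by apply: eq_bigr => l _; rewrite sum1_card card_ord.
Qed.

Lemma card_geo_level (y : 'I_X) : #|[set b | geo_level b == y]| = K ^ y.+1.
Proof. by rewrite (card_geo_block (pred1 y)) big_pred1_eq. Qed.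

Lemma card_geo_below (y : 'I_X) : 1 < K ->
  K * #|[set b : geo_block | geo_level b < y]| <= 2 * #|[set b | geo_level b == y]|.
Proof.
move=> K_gt1; rewrite card_geo_level expnS mulnCA leq_mul2l.
rewrite (card_geo_block (fun l => l < y)).
rewrite -(big_ord_widen _ (fun l => K ^ l.+1)) ?geometric_sum_le ?orbT //.
exact/ltnW.
Qed.

Lemma card_geo : 1 < K -> #|geo_block| <= 2 * K ^ X.
Proof.
move=> K_gt1; rewrite -cardsT (eq_card (B := [set b | predT (geo_level b)])).
  by rewrite card_geo_block geometric_sum_le.
by move=> b; rewrite !inE.
Qed.
End Geometric.

From mathcomp Require Import all_classical all_reals all_analysis.
Import Order.TTheory GRing.Theory Num.Theory.
Import numFieldNormedType.Exports.
Local Open Scope ring_scope.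

(** * The inequality for the number of parts *)

Section Bound.
Variable R : realType.

(** The factor bound is [1 - p >= expR (- p / (1 - p))]. *)
Lemma prod_1B_ge (I : finType) (p : I -> R) (t : R) :
  t < 1 -> (forall i, 0 <= p i <= t) ->
  expR (- (\sum_i p i) / (1 - t)) <= \prod_i (1 - p i).
Proof.
move=> t1 pt; rewrite -sumrN mulr_suml expR_sum; apply: ler_prod => i _.
have /andP[p0 pi_t] := pt i; rewrite expR_ge0 /=.
have p1 : 0 < 1 - p i by lra.
rewrite mulNr expRN invf_ple ?posrE ?expR_gt0 //.
apply: le_trans (_ : expR (p i / (1 - p i)) <= _).
  apply: le_trans (expR_ge1Dx _); rewrite le_eqVlt; apply/orP; left; apply/eqP.
  by field; rewrite lt0r_neq0.
by rewrite ler_expR ler_wpM2l // lef_pV2 ?posrE //; lra.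
Qed.

(** From here on the numbers of blocks of the levels are subject to three
    conditions: few blocks compared with the palette size, so that a random
    function is nearly always injective, many blocks in each level, so that heavy
    blocks matter little, and lower levels of negligible size. *)
Section Level.
Variables (X q d K h : nat) (B : finType) (lev : B -> 'I_X).
Variables (P : {set {set vertex q d B}}) (kind : {set vertex q d B} -> part_kind X q B).
Hypothesis Ppart : finset.partition P [set: vertex q d B]%SET.
Hypothesis kindP : {in P, forall S, has_kind lev (kind S) S}.
Hypotheses (d_gt0 : (0 < d)%N) (K_gt0 : (0 < K)%N) (h_gt0 : (0 < h)%N) (hq : (h < q)%N).
Hypothesis KB : (#|B| ^ 2 * K <= q)%N.
Hypothesis K_level : forall y : 'I_X, (K <= #|[set b | lev b == y]|)%N.
Hypothesis K_below : forall y : 'I_X,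
  (K * #|[set b | (lev b < y)%N]%SET| <= 2 * #|[set b | lev b == y]%SET|)%N.

Local Notation small y := #|small_parts P kind y|.
Local Notation stars y := #|star_parts P kind y|.

(** Up to [1 / K], the left side bounds from below the portion of level [y]
    that is left by the star parts with light blocks.  On the right, the first
    summand is the portion covered by small parts, the last one comes from heavy
    blocks, of which there are at most [#|star_parts P kind y| / h], and [3 / K]
    combines the lower levels, with [2 / K], and the functions that are not
    injective, with [1 / K]. *)
Lemma level_bound y :
  expR (- ((stars y)%:R / (q%:R - h%:R))) <=
  2 * (small y)%:R / d%:R + 3 / K%:R + (stars y)%:R / (h%:R * K%:R) :> R.
Proof.
set t := stars y; set a := small y.
have q_gt0 : (0 < q)%N by apply: leq_trans hq.
have dR : 0 < d%:R :> R by rewrite ltr0n.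
have KR : 0 < K%:R :> R by rewrite ltr0n.
have hR : 0 < h%:R :> R by rewrite ltr0n.
have qR : 0 < q%:R :> R by rewrite ltr0n.
have hqR : h%:R < q%:R :> R by rewrite ltr_nat.
set N := #|[set b | lev b == y]%SET|; set N' := #|[set b | (lev b < y)%N]%SET|.
have NR : K%:R <= N%:R :> R by rewrite ler_nat K_level.
have NR' : K%:R * N'%:R <= 2 * N%:R :> R by rewrite -!natrM ler_nat K_below.
set rows := light_used P kind h y.
set Q := (q ^ #|B|)%N; have QR : 0 < Q%:R :> R by rewrite ltr0n expn_gt0 q_gt0.
have row_lt b : (#|rows b| < h)%N.
  by rewrite /rows /light_used; case: ifPn; rewrite ?cards0 // inE -ltnNge.
have prod_le : expR (- (t%:R / (q%:R - h%:R))) <= \prod_b (1 - #|rows b|%:R / q%:R) :> R.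
  apply: le_trans (_ : _ <= expR (- (\sum_b #|rows b|%:R / q%:R) /
      (1 - h%:R / q%:R))) _; last first.
    apply: prod_1B_ge.
      by rewrite ltr_pdivrMr // mul1r.
    by move=> b; rewrite divr_ge0 ?ler0n //= ler_pM2r ?invr_gt0 // ler_nat ltnW.
  rewrite ler_expR -mulr_suml mulNr lerN2 -natr_sum.
  rewrite (_ : 1 - h%:R / q%:R = (q%:R - h%:R) / q%:R); last first.
    by field; rewrite lt0r_neq0.
  rewrite invf_div mulrA mulfVK ?lt0r_neq0 // ler_pM2r ?invr_gt0 ?subr_gt0 //.
  rewrite ler_nat; apply: leq_trans (sum_card_used P kind y); apply: leq_sum => b _.
  by rewrite /rows /light_used; case: ifP; rewrite ?cards0.
have avoid_ge : \prod_b (1 - #|rows b|%:R / q%:R) <=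
    #|avoiding rows|%:R / Q%:R + K%:R^-1 :> R.
  have -> : \prod_b (1 - #|rows b|%:R / q%:R) = (\prod_b (q - #|rows b|))%N%:R / Q%:R :> R.
    rewrite natr_prod /Q natrX -prodr_const -prodf_div; apply: eq_bigr => b _.
    rewrite natrB; last by apply: leq_trans (max_card _) _; rewrite card_ord.
    by rewrite mulrBl divff ?lt0r_neq0.
  have := card_avoiding rows; move: KB; rewrite -/Q; set B2 := (#|B| ^ 2)%N.
  rewrite -!(ler_nat R) natrD !natrM => NK le.
  rewrite ler_pdivrMr // mulrDl divfK ?lt0r_neq0 // -(ler_pM2l qR).
  apply: (le_trans le); rewrite mulrDr lerD2l mulrA ler_pM2r //.
  by rewrite ler_pdivlMr.
have cover : #|avoiding rows|%:R / Q%:R <=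
    2 * a%:R / d%:R + 2 / K%:R + t%:R / (h%:R * K%:R) :> R.
  have := card_avoiding_le h Ppart kindP y d_gt0.
  rewrite -/a -/N -/N' -/rows -(ler_nat R) !(natrM, natrD) => le.
  have sQ : #|injection q B|%:R <= Q%:R :> R by rewrite ler_nat card_injection.
  have Ht : h%:R * #|heavy P kind h y|%:R <= t%:R :> R.
    by rewrite -natrM ler_nat card_heavy.
  have N_gt0 : 0 < N%:R :> R by apply: lt_le_trans NR.
  set H := #|heavy P kind h y| in le Ht.
  apply: (@le_trans _ _ (2 * a%:R / d%:R + N'%:R / N%:R + H%:R / N%:R)).
    rewrite ler_pdivrMr // -(ler_pM2r dR) -(ler_pM2r N_gt0); apply: (le_trans le).
    rewrite [X in _ <= X](_ : _ =
        Q%:R * (2 * a%:R * N%:R + d%:R * N'%:R + d%:R * H%:R)).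
      by rewrite ler_wpM2r // !addr_ge0 ?mulr_ge0.
    by field; rewrite !lt0r_neq0.
  apply: lerD; first apply: lerD => //.
    by rewrite ler_pdivrMr // mulrAC ler_pdivlMr // mulrC.
  apply: (@le_trans _ _ (H%:R / K%:R)); first by rewrite ler_wpM2l // lef_pV2 ?posrE.
  by rewrite invfM mulrA ler_pM2r ?invr_gt0 // ler_pdivlMr // mulrC.
apply: (le_trans prod_le); apply: (le_trans avoid_ge).
by apply: le_trans (lerD cover (lexx _)) _; lra.
Qed.

(** The sum of [level_bound] over all levels.  Instead of Jensen's inequality, the
    proof bounds each exponential by its tangent at the average [c]. *)
Lemma partition_size_bound : (0 < X)%N ->
  X%:R * expR (- (#|P|%:R / (X%:R * (q%:R - h%:R)))) <=
  2 * #|P|%:R / d%:R + 3 * X%:R / K%:R + #|P|%:R / (h%:R * K%:R) :> R.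
Proof.
move=> X_gt0; set T := #|P|.
have XR : 0 < X%:R :> R by rewrite ltr0n.
have qhR : 0 < q%:R - h%:R :> R by rewrite subr_gt0 ltr_nat.
have dR : 0 < d%:R :> R by rewrite ltr0n.
have hKR : 0 < h%:R * K%:R :> R by rewrite mulr_gt0 ?ltr0n.
set A := (\sum_y small y)%N; set Z := (\sum_y stars y)%N.
have AZ : A%:R + Z%:R <= T%:R :> R.
  rewrite -natrD ler_nat /A /Z -big_split /=.
  pose lvl S := match kind S with inl y => y | inr (y, _, _) => y end.
  rewrite /T -sum1_card (partition_big lvl predT) //=; apply: leq_sum => y _.
  apply: (@leq_trans #|[set S in P | lvl S == y]%SET|); last first.
    by rewrite -sum1_card; apply/eq_leq/eq_bigl => S; rewrite inE.
  rewrite -cardsUI (_ : _ :&: _ = finset.set0)%SET.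
    rewrite cards0 addn0; apply/subset_leq_card/fintype.subsetP => S.
    rewrite !inE /lvl; case: (S \in P) => //=.
    by case: (kind S) => [y'|[[y' b] j]] //= /orP[/eqP[->]|].
  apply/finset.setP => S; rewrite !inE; apply/negP.
  by case/andP=> /andP[_ /eqP ->]; rewrite andbF.
set c := T%:R / (X%:R * (q%:R - h%:R)).
have tangent y : expR (- c) * (1 + c - (stars y)%:R / (q%:R - h%:R)) <=
    expR (- ((stars y)%:R / (q%:R - h%:R))) :> R.
  rewrite -[X in _ <= expR X](addrNK (- c)) expRD mulrC ler_wpM2r ?expR_ge0 //.
  by apply: le_trans (expR_ge1Dx _); lra.
have main : \sum_y expR (- c) * (1 + c - (stars y)%:R / (q%:R - h%:R)) <=
    \sum_y (2 * (small y)%:R / d%:R + 3 / K%:R + (stars y)%:R / (h%:R * K%:R)) :> R.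
  by apply: ler_sum => y _; apply: le_trans (tangent y) (level_bound y).
apply: (@le_trans _ _ (expR (- c) * (X%:R * (1 + c) - Z%:R / (q%:R - h%:R)))).
  rewrite mulrC ler_wpM2l ?expR_ge0 // mulrDr mulr1 -addrA lerDl subr_ge0.
  have -> : X%:R * c = T%:R / (q%:R - h%:R).
    by rewrite /c; field; rewrite !lt0r_neq0.
  rewrite ler_pM2r ?invr_gt0 //; apply: le_trans AZ.
  by rewrite lerDr ler0n.
move: main; rewrite -mulr_sumr sumrB sumr_const card_ord -mulr_suml -natr_sum -/Z.
rewrite -[_ *+ X]mulr_natl => /le_trans; apply.
rewrite !big_split /= sumr_const card_ord -!mulr_suml -mulr_sumr -!natr_sum -/Z -/A.
rewrite -[_ *+ X]mulr_natl.
apply: lerD; first apply: lerD.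
- by rewrite ler_pM2r ?invr_gt0 // ler_pM2l //; have := ler0n R Z; lra.
- by rewrite mulrA [X in X / _]mulrC.
by rewrite ler_pM2r ?invr_gt0 //; have := ler0n R A; lra.
Qed.

End Level.

End Bound.

(** * Parameters and asymptotics *)

Lemma exists_colour_embedding (X q d r : nat) : (X * q + d <= r)%N ->
  exists emb : colour X q d -> 'I_r, injective emb.
Proof.
move=> le; have le' : (#|colour X q d| <= r)%N.
  by rewrite card_sum card_prod !card_ord.
exists (fun c => widen_ord le' (enum_rank c)) => c c' /(congr1 val) /= e.
exact/enum_rank_inj/val_inj.
Qed.

(** With levels of geometric sizes there are at most [2 * K ^ X] blocks, which is
    where the condition [4 * K ^ (2 * X + 1) <= q] comes from. *)
Lemma partition_bound_inequality (R : realType) (X q d K h r k T : nat) :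
  (0 < k)%N -> (0 < X)%N -> (0 < d)%N -> (1 < K)%N -> (0 < h)%N -> (h < q)%N ->
  (4 * K ^ (2 * X + 1) <= q)%N -> (X * q + d <= r)%N ->
  partition_bound k r T ->
  X%:R * expR (- (T%:R / (X%:R * (q%:R - h%:R)))) <=
  2 * T%:R / d%:R + 3 * X%:R / K%:R + T%:R / (h%:R * K%:R) :> R.
Proof.
move=> k_gt0 X_gt0 d_gt0 K_gt1 h_gt0 hq Kq /exists_colour_embedding[emb emb_inj] bound.
have K_gt0 : (0 < K)%N by exact: ltnW.
pose lev := @geo_level X K.
have [|P [Ppart PT Padm]] := bound (vertex q d (geo_block X K))
    (fun u v => emb (edge_colour lev u v)).
  by move=> u v; rewrite edge_colourC.
have /fin_all_exists[kind kindP] : forall S : {set vertex q d (geo_block X K)},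
    exists c, S \in P -> has_kind lev c S.
  move=> S; case SP: (S \in P); last by exists (inl (Ordinal X_gt0)).
  by have [c cS] := admissible_part_kind k_gt0 d_gt0 emb_inj (Padm S SP); exists c.
have KB : (#|geo_block X K| ^ 2 * K <= q)%N.
  apply: leq_trans Kq; rewrite addn1 (expnSr K) mulnA leq_mul2r.
  rewrite (mulnC 2) expnM (_ : 4 = 2 ^ 2)%N // -expnMn leq_sqr.
  by rewrite card_geo ?orbT.
have := @partition_size_bound R X q d K h _ lev P kind Ppart kindP d_gt0 K_gt0 h_gt0 hq KB.
have K_level y : (K <= #|[set b | lev b == y]%SET|)%N.
  by rewrite card_geo_level expnS leq_pmulr // expn_gt0 K_gt0.
move=> /(_ K_level (fun y => card_geo_below y K_gt1) X_gt0) main.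
have PTR : #|P|%:R <= T%:R :> R by rewrite ler_nat.
have XR : 0 < X%:R :> R by rewrite ltr0n.
have qhR : 0 < q%:R - h%:R :> R by rewrite subr_gt0 ltr_nat.
apply: le_trans (le_trans main _).
  by rewrite ler_pM2l // ler_expR lerN2 ler_pM2r ?invr_gt0 ?mulr_gt0.
apply: lerD; first apply: lerD => //.
  by rewrite ler_pM2r ?invr_gt0 ?ltr0n // ler_pM2l.
by rewrite ler_wpM2r // invr_ge0 mulr_ge0.
Qed.

Section Numerics.
Variable R : realType.
Implicit Types (e z r : R).

Lemma expR_ge_cube (x : R) : 0 <= x -> x ^+ 3 / 6 <= expR x.
Proof. by move=> /(expR_ge1Dxn 2); rewrite !factS fact0 !muln1; lra. Qed.

(** In terms of [z = ln (ln r)]: the first summand on the left is [O(z / e)], the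
    others make up at most half of the right side, and the right side is at least
    of order [expR (e * z / 2) / z].  By the cubic bound on the exponential
    function, it suffices that [z * e ^+ 4] exceeds [61440 = 8 * 7680], where
    [7680 = 16 * 80 * 6] collects the constants of [term1], [half2] and [wcube]. *)
Lemma numeric_contradiction e z (X q h d K T r : R) :
  0 < e < 1 -> 10 ^+ 5 <= z * e ^+ 4 ->
  expR z <= 40 * z * X -> expR (2 * z) <= K -> e / 8 * r <= d ->
  r <= 2 * (X * q) -> (1 - 3 * e / 8) * r <= X * (q - h) -> e / 8 * q <= h ->
  0 < r -> 0 < X -> 0 < q -> 0 <= T -> T < (1 - e) * (r * z) ->
  2 * T / d + 3 * X / K + T / (h * K) < X * expR (- (T / (X * (q - h)))).
Proof.
move=> /andP[e0 e1] ze4 zX KE dr rXq rXqh hq r0 X0 q0 T0 Tlt.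
have e4 : e ^+ 4 <= 1 by rewrite exprn_ile1 ?ltW.
have z0 : 0 < z.
  rewrite ltNge; apply/negP => zle; have : z * e ^+ 4 <= 0.
    by rewrite mulr_le0_ge0 // exprn_ge0 // ltW.
  lra.
have zbig : 10 ^+ 5 <= z by apply: le_trans ze4 _; rewrite ler_piMr // ltW.
have ze : 10 ^+ 5 <= z * e.
  apply: le_trans ze4 _; apply: ler_wpM2l; first exact: ltW.
  by rewrite exprS ler_piMr ?exprn_ile1 ?ltW.
have [ze' ee'] := (ltW z0, ltW e0).
set i := e^-1; have ei : e * i = 1 by rewrite divff ?lt0r_neq0.
have i0 : 0 < i by rewrite invr_gt0.
have iz : 16 * i <= z.
  rewrite -(ler_pM2l e0) mulrCA ei; lra.
set E := expR z; set w := expR (e * z / 2).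
have E0 : 0 < E by exact: expR_gt0.
have w0 : 0 < w by exact: expR_gt0.
have Ecube : z ^+ 3 / 6 <= E by rewrite expR_ge_cube.
have wcube : (e * z / 2) ^+ 3 / 6 <= w.
  by rewrite expR_ge_cube // divr_ge0 // mulr_ge0.
have w1 : 1 <= w.
  by apply: le_trans (expR_ge1Dx _); rewrite lerDl divr_ge0 // mulr_ge0.
have d0 : 0 < d by apply: lt_le_trans dr; rewrite mulr_gt0 // divr_gt0.
have h0 : 0 < h by apply: lt_le_trans hq; rewrite mulr_gt0 // divr_gt0.
have KE2 : E ^+ 2 <= K by rewrite -expRM_natl.
have K0 : 0 < K by apply: lt_le_trans KE2; rewrite exprn_gt0.
have den0 : 0 < X * (q - h).
  by apply: lt_le_trans rXqh; rewrite mulr_gt0 //; lra.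
have rz0 : 0 < r * z by rewrite mulr_gt0.
(* [(1 - e) / (1 - 3 * e / 8) <= 1 - e / 2] *)
have exponent : T / (X * (q - h)) <= z - e * z / 2.
  rewrite ler_pdivrMr //; apply: (le_trans (ltW Tlt)).
  apply: (@le_trans _ _ ((z - e * z / 2) * ((1 - 3 * e / 8) * r))); last first.
    by rewrite ler_wpM2l //; nra.
  rewrite (_ : (z - _) * _ = (1 - e / 2) * (1 - 3 * e / 8) * (r * z)); last by ring.
  by rewrite ler_pM2r //; nra.
have decay : X * (w / E) <= X * expR (- (T / (X * (q - h)))).
  rewrite ler_pM2l // -expRN -expRD ler_expR; lra.
have Trz : T <= r * z by apply: (le_trans (ltW Tlt)); rewrite ler_piMl ?ltW //; lra.
have term1 : 2 * T / d <= 16 * i * z.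
  rewrite ler_pdivrMr //; apply: (@le_trans _ _ (16 * i * z * (e / 8 * r))).
    rewrite (_ : _ * (e / 8 * r) = e * i * (2 * (r * z))); last by field.
    by rewrite ei mul1r ler_pM2l.
  by rewrite ler_wpM2l // !mulr_ge0 ?ltW.
have term2 : 3 * X / K <= 3 * X / E ^+ 2.
  by rewrite ler_pM2l ?mulr_gt0 // lef_pV2 ?posrE ?exprn_gt0.
have term3 : T / (h * K) <= 16 * i * z * X / E ^+ 2.
  rewrite ler_pdivrMr ?mulr_gt0 //.
  apply: (@le_trans _ _ (16 * i * z * X / E ^+ 2 * (e / 8 * q * E ^+ 2))); last first.
    apply: ler_wpM2l; first by rewrite divr_ge0 ?mulr_ge0 ?exprn_ge0 // ltW.
    by apply: ler_pM => //; rewrite ?mulr_ge0 ?divr_ge0 ?exprn_ge0 // ltW.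
  rewrite (_ : _ * (_ * E ^+ 2) = e * i * (z * (2 * (X * q)))); last first.
    by field; rewrite lt0r_neq0.
  by rewrite ei mul1r (le_trans Trz) // mulrC ler_pM2l.
have half1 : (3 + 16 * i * z) / E ^+ 2 <= w / E / 2.
  rewrite expr2 invfM mulrA [w / E / 2]mulrAC ler_pM2r ?invr_gt0 //.
  rewrite ler_pdivrMr //; apply: (@le_trans _ _ (1 / 2 * E)); last first.
    by rewrite ler_pM2r // ler_pM2r.
  have : 16 * i * z <= z ^+ 2 by rewrite expr2 ler_pM2r.
  have : 10 ^+ 5 * z ^+ 2 <= z ^+ 3 by rewrite [z ^+ 3]exprS ler_pM2r // exprn_gt0.
  have : 10 ^+ 5 * z <= z ^+ 2 by rewrite expr2 ler_pM2r.
  lra.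
have half2 : 16 * i * z < X * (w / E / 2).
  apply: (@lt_le_trans _ _ (w / (80 * z))); last first.
    rewrite ler_pdivrMr ?mulr_gt0 //.
    rewrite (_ : _ * (80 * z) = w * (40 * z * X / E)); last by field; rewrite lt0r_neq0.
    by rewrite ler_pMr // ler_pdivlMr // mul1r.
  rewrite ltr_pdivlMr ?mulr_gt0 //; apply: lt_le_trans wcube.
  rewrite ltr_pdivlMr // (_ : (e * z / 2) ^+ 3 = i * z ^+ 2 * (z * e ^+ 4) / 8).
    rewrite (_ : _ * 6 = i * z ^+ 2 * (16 * 80 * 6)); last by ring.
    rewrite -[X in _ < X]mulrA ltr_pM2l ?mulr_gt0 ?exprn_gt0 //; lra.
  by rewrite -[LHS]mul1r -[X in X * _]ei; field.
have eq1 : X * (w / E) = X * (w / E / 2) + X * (w / E / 2) by field; rewrite lt0r_neq0.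
apply: lt_le_trans decay; rewrite {}eq1.
apply: le_lt_trans (_ : 16 * i * z + X * ((3 + 16 * i * z) / E ^+ 2) < _).
  apply: le_trans (lerD (lerD term1 term2) term3) _.
  by rewrite le_eqVlt; apply/orP; left; apply/eqP; field; rewrite lt0r_neq0.
by apply: ltr_leD => //; rewrite ler_pM2l.
Qed.

Lemma nat_ceil_approx (x : R) : 0 <= x ->
  exists n : nat, [/\ (0 < n)%N, x <= n%:R & n%:R <= x + 1].
Proof.
move=> x0; exists (Num.trunc x).+1; have /andP[lo hi] := truncn_itv x0.
by rewrite (ltW hi) -natr1 lerD2r.
Qed.

(** With [L = ln r] the choices are [X] about [L / (40 * z)], [K] about [L ^+ 2],
    [d] about [e / 8 * r], [q = (r - d) %/ X] and [h] about [e / 8 * q].  The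
    constant 40 keeps [4 * K ^ (2 * X + 1)] below the square root of [r], which is
    less than [q]. *)
Lemma parameters e z (r : nat) :
  0 < e < 1 -> 10 ^+ 5 <= z * e ^+ 4 -> r%:R = expR (expR z) :> R ->
  exists X q d K h : nat,
  [/\ [/\ (0 < X)%N, (0 < d)%N, (1 < K)%N, (0 < h)%N & (h < q)%N],
      (4 * K ^ (2 * X + 1) <= q)%N, (X * q + d <= r)%N &
   [/\ expR z <= 40 * z * X%:R, expR (2 * z) <= K%:R, e / 8 * r%:R <= d%:R,
       r%:R <= 2 * (X%:R * q%:R) :> R &
       (1 - 3 * e / 8) * r%:R <= X%:R * (q%:R - h%:R) /\ e / 8 * q%:R <= h%:R]].
Proof.
move=> /andP[e0 e1] ze4 rE; set L := expR z in rE *.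
have z0 : 0 < z.
  rewrite ltNge; apply/negP => zle; have : z * e ^+ 4 <= 0.
    by rewrite mulr_le0_ge0 // exprn_ge0 // ltW.
  lra.
have ze : 10 ^+ 5 <= z * e.
  apply: le_trans ze4 _; apply: ler_wpM2l; first exact: ltW.
  by rewrite exprS ler_piMr ?exprn_ile1 ?ltW.
have zbig : 10 ^+ 5 <= z by apply: le_trans ze _; rewrite ler_piMr // ltW.
have [ze' ee'] := (ltW z0, ltW e0).
have L0 : 0 < L by exact: expR_gt0.
have L0' := ltW L0.
have Lcube : z ^+ 3 / 6 <= L by rewrite expR_ge_cube.
have zL : 10 ^+ 3 * z <= L.
  apply: le_trans Lcube; rewrite ler_pdivlMr // [z ^+ 3]exprSr.
  rewrite mulrAC ler_pM2r //; have : 10 ^+ 5 * z <= z ^+ 2 by rewrite expr2 ler_pM2r.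
  lra.
have r0 : 0 < r%:R :> R by rewrite rE expR_gt0.
have rcube : L ^+ 3 / 6 <= r%:R by rewrite rE expR_ge_cube.
have [X [X0 X1 X2]] := nat_ceil_approx (divr_ge0 L0' (mulr_ge0 (ler0n R 40) ze')).
have [d [d0 d1 d2]] := nat_ceil_approx (mulr_ge0 (divr_ge0 ee' (ler0n R 8)) (ltW r0)).
have [K [K0 K1 K2]] := nat_ceil_approx (exprn_ge0 2 L0').
have XR : 0 < X%:R :> R by rewrite ltr0n.
have XL : X%:R <= L.
  apply: (le_trans X2); have : L / (40 * z) <= L / 40.
    rewrite ler_pM2l // lef_pV2 ?posrE ?mulr_gt0 // ler_peMr //; lra.
  lra.
have small : 1 + 2 * X%:R <= e / 8 * r%:R.
  apply: (@le_trans _ _ (e / 8 * (L ^+ 3 / 6))); last by rewrite ler_pM2l // divr_gt0.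
  have eL : 1 <= e * L.
    apply: (@le_trans _ _ (z * e)); first by clear -ze; lra.
    by rewrite mulrC (ler_pM2l e0); clear -zL z0; lra.
  apply: (@le_trans _ _ (L ^+ 2 / 48)); last first.
    rewrite (_ : e / 8 * _ = (e * L) * (L ^+ 2 / 48)); last by field.
    by rewrite ler_peMl // divr_ge0 // exprn_ge0.
  have : 2 * 10 ^+ 2 * L <= L ^+ 2 by rewrite expr2 ler_pM2r //; lra.
  lra.
have er : e / 8 * r%:R <= r%:R / 8.
  by rewrite mulrAC ler_pM2r // ler_piMl // ltW.
have dr : (d <= r)%N by rewrite -(ler_nat R); lra.
set q := ((r - d) %/ X)%N.
have qlo : X%:R * q%:R + d%:R <= r%:R :> R.
  rewrite -natrM -natrD ler_nat mulnC.
  by rewrite -(subnK dr) leq_add2r leq_trunc_div.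
have qhi : r%:R <= X%:R * q%:R + X%:R + d%:R :> R.
  have := ltn_ceil (r - d) X0; rewrite -/q mulSn => lt.
  by rewrite -natrM -!natrD ler_nat -[X in (X <= _)%N](subnK dr) leq_add2r addnC mulnC ltnW.
have q0 : 0 <= q%:R :> R by [].
have [h [h0 h1 h2]] := nat_ceil_approx (mulr_ge0 (divr_ge0 ee' (ler0n R 8)) q0).
have Xh : X%:R * h%:R <= e / 8 * (X%:R * q%:R) + X%:R.
  by rewrite mulrCA -[X in _ + X]mulr1 -mulrDr ler_pM2l.
have Xqh : (1 - 3 * e / 8) * r%:R <= X%:R * (q%:R - h%:R).
  have qr : X%:R * q%:R <= r%:R :> R by apply: le_trans qlo; rewrite lerDl.
  have := ler_wpM2l (divr_ge0 ee' (ler0n R 8)) qr.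
  by rewrite mulrBr; lra.
have qbig : r%:R <= 2 * (X%:R * q%:R) :> R by lra.
have hq : (h < q)%N.
  rewrite -(ltr_nat R) -subr_gt0 -(pmulr_rgt0 _ XR); apply: lt_le_trans Xqh.
  by rewrite mulr_gt0 //; lra.
have K3 : K%:R <= expR (3 * z).
  rewrite expRM_natl -/L; apply: (le_trans K2).
  have : 10 ^+ 2 * L ^+ 2 <= L ^+ 3 by rewrite [L ^+ 3]exprS ler_pM2r ?exprn_gt0 //; lra.
  have : 1 <= L ^+ 2 by rewrite exprn_ege1 //; lra.
  lra.
have Kq : (4 * K ^ (2 * X + 1) <= q)%N.
  rewrite -(ler_nat R) natrM natrX; apply: (@le_trans _ _ (expR (L / 2))).
    apply: (@le_trans _ _ (expR z * expR (3 * z) ^+ (2 * X + 1))).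
      apply: ler_pM => //; first by apply: le_trans (expR_ge1Dx _); lra.
      by rewrite lerXn2r ?nnegrE ?expR_ge0.
    rewrite -expRM_natl -expRD ler_expR natrD natrM.
    have : X%:R * z <= L / 40 + z.
      rewrite (_ : L / 40 + z = (L / (40 * z) + 1) * z); last by field; rewrite lt0r_neq0.
      by rewrite ler_pM2r.
    lra.
  have half : 2 * L <= expR (L / 2).
    apply: (@le_trans _ _ ((L / 2) ^+ 3 / 6)); last by rewrite expR_ge_cube // divr_ge0.
    rewrite (_ : _ / 6 = L * (L ^+ 2 / 48)); last by field.
    rewrite mulrC ler_pM2l //; have : 2 * 10 ^+ 2 * L <= L ^+ 2 by rewrite expr2 ler_pM2r //; lra.
    lra.
  have : 2 * L * q%:R >= expR (L / 2) * expR (L / 2).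
    rewrite -expRD -splitr -rE; apply: (le_trans qbig).
    by rewrite mulrA ler_wpM2r // ler_pM2l.
  move=> le; rewrite -(ler_pM2l (expR_gt0 (L / 2))); apply: (le_trans le).
  by rewrite ler_wpM2r.
exists X, q, d, K, h; split=> //.
- split=> //; rewrite -(ltr_nat R); apply: lt_le_trans K1.
  by rewrite exprn_egt1 //; lra.
- by rewrite -(ler_nat R) natrD natrM.
split=> //; last by rewrite expRM_natl.
by move: X1; rewrite ler_pdivrMr ?mulr_gt0 // mulrC.
Qed.

Lemma partition_bound_ge e (r k T : nat) :
  0 < e < 1 -> 10 ^+ 5 <= ln (ln r%:R) * e ^+ 4 -> (0 < k)%N ->
  partition_bound k r T -> (1 - e) * (r%:R * ln (ln r%:R)) <= T%:R.
Proof.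
set z := ln (ln r%:R) => e01 ze4 k_gt0 bound.
have /andP[e0 e1] := e01.
have z0 : 0 < z.
  rewrite -(pmulr_lgt0 _ (exprn_gt0 4 e0)); apply: lt_le_trans ze4.
  by rewrite exprn_gt0.
have lnr0 : 0 < ln (r%:R : R).
  by rewrite ltNge; apply/negP => /ln0 z_eq0; rewrite /z z_eq0 ltxx in z0.
have r0 : 0 < r%:R :> R.
  by rewrite ltNge; apply/negP => /ln0 r_eq0; rewrite r_eq0 ltxx in lnr0.
have rE : r%:R = expR (expR z) :> R by rewrite /z !lnK ?posrE.
have [X [q [d [K [h [[X0 d0 K1 h0 hq] Kq Xqd [zX LK er rXq [rXqh eq]]]]]]]] :=
  parameters e01 ze4 rE.
rewrite leNgt; apply/negP => Tlt.
have := partition_bound_inequality R k_gt0 X0 d0 K1 h0 hq Kq Xqd bound.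
rewrite leNgt => /negP; apply.
by apply: numeric_contradiction Tlt; rewrite // ltr0n // (ltn_trans h0).
Qed.

(** The value of [e] for which [ln (ln r) * e ^+ 4] is the constant demanded by
    [partition_bound_ge]. *)
Definition error_term (r : nat) : R := Num.sqrt (Num.sqrt (10 ^+ 5 / ln (ln r%:R))).

Lemma ln_ln_nat_large (A : R) : exists r0 : nat,
  forall r : nat, (r0 <= r)%N -> A <= ln (ln r%:R).
Proof.
exists (Num.trunc (expR (expR A))).+1 => r r0r.
have rA : expR (expR A) <= r%:R.
  by apply: le_trans (ltW (truncnS_gt _)) _; rewrite ler_nat.
have lnr : expR A <= ln (r%:R : R).
  by rewrite -[X in X <= _]expRK ler_ln ?posrE ?expR_gt0 // (lt_le_trans _ rA) ?expR_gt0.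
rewrite -[X in X <= _]expRK ler_ln ?posrE ?expR_gt0 //.
by rewrite (lt_le_trans _ lnr) ?expR_gt0.
Qed.

Local Open Scope classical_set_scope.

Lemma cvg_error_term : error_term @ \oo --> (0 : R).
Proof.
have lnln_y : (fun r : nat => ln (ln (r%:R : R))) @ \oo --> +oo.
  apply/cvgryPge => A; have [r0 r0P] := ln_ln_nat_large A.
  by exists r0 => // r /= /r0P.
have inv0 : (fun r : nat => (ln (ln (r%:R : R)))^-1) @ \oo --> (0 : R).
  apply/(gtr0_cvgV0 (f := fun r : nat => ln (ln (r%:R : R)))) => //.
  have [r0 r0P] := ln_ln_nat_large 1.
  by exists r0 => // r /= /r0P; apply: lt_le_trans.
have quot0 : (fun r : nat => 10 ^+ 5 / ln (ln (r%:R : R))) @ \oo --> (0 : R).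
  by rewrite -[X in _ --> X](mulr0 (10 ^+ 5 : R)); apply: cvgMl_tmp.
have root0 : (fun r : nat => Num.sqrt (10 ^+ 5 / ln (ln (r%:R : R)))) @ \oo --> (0 : R).
  rewrite -[X in _ --> X](sqrtr0 R); apply: continuous_cvg quot0.
  exact: sqrt_continuous.
rewrite -[X in _ --> X](sqrtr0 R); apply: continuous_cvg root0.
exact: sqrt_continuous.
Qed.
Local Close Scope classical_set_scope.
End Numerics.

Local Open Scope classical_set_scope.

Theorem proposition1p6 (R : realType) :
  exists (eps : nat -> R) (r0 : nat),
    (eps @ \oo --> (0 : R)) /\
    forall r k : nat, (r0 <= r)%N -> (2 <= k)%N ->
      (((1 - eps r) * (r%:R * ln (ln (r%:R : R))))%:E <= pk R k r)%E.
Proof.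
have [r0 r0P] := ln_ln_nat_large (10 ^+ 5 + 1 : R).
exists (@error_term R), r0; split; first exact: cvg_error_term.
move=> r k /r0P z_big k_ge2; apply: le_ereal_inf_tmp => _ [T /= bound <-].
rewrite lee_fin; set z := ln (ln r%:R) in z_big *.
have c0 : 0 < 10 ^+ 5 :> R by rewrite exprn_gt0.
have z0 : 0 < z by lra.
have zV0 : 0 < 10 ^+ 5 / z by rewrite divr_gt0.
apply: (partition_bound_ge (k := k)) => //; last exact: ltnW.
  rewrite /error_term -/z !sqrtr_gt0 zV0 /=.
  rewrite -[X in _ < X]sqrtr1 ltr_sqrt // -[X in _ < X]sqrtr1 ltr_sqrt //.
  by rewrite ltr_pdivrMr // mul1r; lra.
rewrite /error_term -/z (exprM _ 2 2) sqr_sqrtr ?sqrtr_ge0 //.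
by rewrite (sqr_sqrtr (ltW zV0)) mulrC divfK ?lt0r_neq0.
Qed.
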